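(* Let $x\in\{0,1\}^{\mathbb{Z}^2}$ be strongly recurrent. Then $x$ is doubly periodic if and only if $\sup_{k\geq1}p_x^{*\mathrm{ab}}(k)<\infty$.
   Context: For a finite set $S\subset\mathbb{Z}^2$ and $t\in\mathbb{Z}^2$, the $S$-factor of $x$ at $t$ is $x[t+S]=(x(t+s))_{s\in S}$. Two $S$-factors are Abelian equivalent if each letter occurs the same number of times in both. Let $p_x^{\mathrm{ab}}(S)$ be the number of Abelian equivalence classes of $S$-factors of $x$ (over all $t\in\mathbb{Z}^2$), and $p_x^{*\mathrm{ab}}(k)=\sup\{p_x^{\mathrm{ab}}(S): S\subset\mathbb{Z}^2,\ \#S=k\}$ for $k\ge 1$. $x$ is doubly periodic if there are two linearly independent vectors $p\in\mathbb{Z}^2$ with $x(t+p)=x(t)$ for all $t\in\mathbb{Z}^2$. $\mathbb{P}^1(\mathbb{R})$ is the set of lines through $0$ in $\mathbb{R}^2$; $\operatorname{dir}(q)=\mathbb{R}q$ for $q\neq0$; identifying $\mathbb{P}^1(\mathbb{R})$ with $\mathbb{R}/\pi\mathbb{Z}$ by angle, $d_\pi([\theta],[\phi])=\min_{m\in\mathbb{Z}}|\theta-\phi-m\pi|$. Let $\Sigma_N=[-N,N]^2\cap\mathbb{Z}^2$. $x$ is strongly recurrent if there is $\delta>0$ such that for every $N\geq1$ there are nonzero $u_N,v_N\in\mathbb{Z}^2$ with $x(z+u_N)=x(z)=x(z+v_N)$ for all $z\in\Sigma_N$ and $d_\pi(\operatorname{dir}(u_N),\operatorname{dir}(v_N))\geq\delta$.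 *)

(* Defs.v *)
From HB Require Import structures.
From mathcomp Require Import all_boot all_order all_algebra finmap.
From mathcomp Require Import all_classical all_reals all_analysis.

Set Implicit Arguments.
Unset Strict Implicit.
Unset Printing Implicit Defensive.

Import Order.TTheory GRing.Theory Num.Theory.

Local Open Scope classical_set_scope.
Local Open Scope ring_scope.

Notation Z2 := (int * int)%type.

Section AbelianComplexity.
Variables (A : finType) (x : Z2 -> A).

Definition S_factor (S : {fset Z2}) (t : Z2) : {ffun S -> A} :=
  [ffun s => x (t + fsval s)].

Definition S_factors (S : {fset Z2}) : {set {ffun S -> A}} :=
  [set f | `[< exists t, f = S_factor S t >]]%SET.

Definition abelian_equiv (S : {fset Z2}) : rel {ffun S -> A} :=
  fun f g => [forall a, #|[pred s | f s == a]| == #|[pred s | g s == a]|].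

Definition abelian_complexity (S : {fset Z2}) : nat :=
  #|equivalence_partition (@abelian_equiv S) (S_factors S)|.

Definition max_abelian_complexity (R : realType) (k : nat) : \bar R :=
  ereal_sup [set ((abelian_complexity S)%:R)%:E | S in [set S | #|` S| = k]].

End AbelianComplexity.

Section Directions.
Variable R : realType.

Notation R2 := (R^o * R^o)%type.

Definition to_R2 (q : Z2) : R2 := (q.1%:~R, q.2%:~R).

Definition dir (q : Z2) : {vspace R2} := <[to_R2 q]>%VS.

Definition line_of_angle (theta : R) : {vspace R2} :=
  <[(cos theta, sin theta) : R2]>%VS.

(* An angle of the line [L], determined up to a multiple of [pi]; the default
   value 0 is taken only when [L] is not one-dimensional. *)
Definition angle (L : {vspace R2}) : R :=
  xget 0 [set theta | L = line_of_angle theta].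

(* The infimum is attained, because [pi * int] is discrete in [R]. *)
Definition dist_mod_pi (theta phi : R) : R :=
  inf (range (fun m : int => `|theta - phi - m%:~R * pi|)).

Definition d_pi (L M : {vspace R2}) : R := dist_mod_pi (angle L) (angle M).

End Directions.

Definition doubly_periodic (R : realType) (A : Type) (x : Z2 -> A) : Prop :=
  exists p q : Z2, [/\ free [:: to_R2 R p; to_R2 R q],
    (forall t : Z2, x (t + p) = x t) & (forall t : Z2, x (t + q) = x t)].

Definition in_box (N : nat) (z : Z2) : Prop :=
  (- N%:Z <= z.1 <= N%:Z) /\ (- N%:Z <= z.2 <= N%:Z).

Definition strongly_recurrent (R : realType) (A : Type) (x : Z2 -> A) : Prop :=
  exists delta : R, 0 < delta /\
    forall N : nat, (1 <= N)%N ->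
      exists u v : Z2, [/\ u != 0, v != 0,
        (forall z : Z2, in_box N z -> x (z + u) = x z /\ x z = x (z + v)) &
        delta <= d_pi (dir R u) (dir R v)].

(* Main.v *)
Require Import Defs.
From HB Require Import structures.
From mathcomp Require Import all_boot all_order all_algebra finmap.
From mathcomp Require Import all_classical all_reals all_analysis.
From mathcomp Require Import zify ring.

Set Implicit Arguments.
Unset Strict Implicit.
Unset Printing Implicit Defensive.

Import Order.TTheory GRing.Theory Num.Theory.

Local Open Scope classical_set_scope.
Local Open Scope ring_scope.

(* Over a binary alphabet the abelian class of a factor is its number of ones. If
   [x] is recurrent, a point of Z^2 can be replaced by any number of distinct
   copies that look the same from finitely many given translates. Giving the j-th
   separating point multiplicity 2^j makes the number of ones encode in binary the
   whole pattern seen by a translate, so pairwise distinct translates of [x] yield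
   pairwise inequivalent factors. Bounded abelian complexity thus leaves only
   finitely many translates, and two of the translates by (k,0), as well as two of
   those by (0,k), must coincide. *)

(** * Multiples of vectors and of periods *)

Lemma mulrz_pair (p : Z2) (m : int) : p *~ m = (p.1 * m, p.2 * m).
Proof. by rewrite [LHS]surjective_pairing !raddfMz !mulrzz. Qed.

Lemma mulrn_inj (p : Z2) : p != 0 -> injective (GRing.natmul p).
Proof.
move=> p0 i j; rewrite !pmulrn !mulrz_pair => -[e1 e2].
move: p0 e1 e2; case: p => a b /=; rewrite -pair_eqE /= negb_and.
by case/orP => c0 e1 e2; [case: (mulfI c0 e1)|case: (mulfI c0 e2)].
Qed.

Section Periods.
Variables (A : Type) (x : Z2 -> A).

Lemma period_mulrn (p : Z2) (n : nat) :
  (forall t, x (t + p) = x t) -> forall t, x (t + p *+ n) = x t.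
Proof.
move=> hp; elim: n => [|n IHn] t; first by rewrite mulr0n addr0.
by rewrite mulrS addrA IHn hp.
Qed.

Lemma period_mulrz (p : Z2) (m : int) :
  (forall t, x (t + p) = x t) -> forall t, x (t + p *~ m) = x t.
Proof.
move=> hp t; case: m => n; first by rewrite -pmulrn period_mulrn.
rewrite NegzE mulrNz -pmulrn -[in RHS](subrK (p *+ n.+1) t).
by rewrite (period_mulrn n.+1 hp).
Qed.

End Periods.

(** * Double periodicity bounds the complexity *)

Lemma free_to_R2 (R : realType) (p q : Z2) :
  free [:: to_R2 R p; to_R2 R q] = (p.1 * q.2 - p.2 * q.1 != 0).
Proof.
rewrite free_cons span_seq1 seq1_free.
apply/idP/idP => [/andP[/negP npq q0]|D0].
  apply/negP => /eqP D0; apply: npq; apply/vlineP.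
  have D0R : p.1%:~R * q.2%:~R = p.2%:~R * q.1%:~R :> R.
    by rewrite -!intrM; congr (_%:~R); apply/eqP; rewrite -subr_eq0 D0.
  move: q0; rewrite /to_R2 -pair_eqE /= negb_and => /orP[c0|c0].
    exists (p.1%:~R / q.1%:~R); congr pair; rewrite /GRing.scale /=;
      first by rewrite divfK.
    by rewrite mulrAC D0R mulfK.
  exists (p.2%:~R / q.2%:~R); congr pair; rewrite /GRing.scale /=;
      last by rewrite divfK.
  by rewrite mulrAC -D0R mulfK.
apply/andP; split.
  apply/negP => /vlineP[k] [e1 e2].
  move/eqP: D0; apply; apply/eqP; rewrite -(intr_eq0 R) intrB !intrM e1 e2.
  by rewrite /GRing.scale /=; apply/eqP; ring.
apply: contra D0; rewrite /to_R2 -pair_eqE /= !intr_eq0 => /andP[/eqP -> /eqP ->].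
by rewrite !mulr0 subrr.
Qed.

(** Cramer's rule: the adjugate of the matrix with rows [p] and [q] writes [d] times each unit
    vector as an integer combination of the two periods. *)
Lemma doubly_periodic_axes (R : realType) (A : Type) (x : Z2 -> A) :
  doubly_periodic R x ->
  exists2 D : nat, (0 < D)%N &
    (forall t, x (t + (D%:Z, 0)) = x t) /\ (forall t, x (t + (0, D%:Z)) = x t).
Proof.
case=> p [q [+ hp hq]]; rewrite free_to_R2.
set d := _ - _ => d0; exists `|d|%N; first by rewrite absz_gt0.
(* The factor [m] will be the sign of [d], which turns [d] into its absolute value. *)
have axes (m : int) : (forall t, x (t + (m * d, 0)) = x t) /\
    (forall t, x (t + (0, m * d)) = x t).
  split=> t.
    have -> : (m * d, 0) = p *~ (m * q.2) + q *~ (- (m * p.2)) :> Z2.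
      by rewrite !mulrz_pair; congr pair => /=; rewrite /d; ring.
    by rewrite addrA !period_mulrz.
  have -> : (0, m * d) = p *~ (- (m * q.1)) + q *~ (m * p.1) :> Z2.
    by rewrite !mulrz_pair; congr pair => /=; rewrite /d; ring.
  by rewrite addrA !period_mulrz.
by rewrite abszE normrEsg; exact: axes.
Qed.

(** A factor depends only on its position modulo [D] in each coordinate, so the bound already holds
    for the factors themselves. *)
Lemma abelian_complexity_axes_le (A : finType) (x : Z2 -> A) (D : nat) :
  (0 < D)%N ->
  (forall t, x (t + (D%:Z, 0)) = x t) -> (forall t, x (t + (0, D%:Z)) = x t) ->
  forall S, (abelian_complexity x S <= D * D)%N.
Proof.
move=> D0 hp hq S; apply: leq_trans (leq_imset_card _ _) _.
pose f (i : 'I_D * 'I_D) := S_factor x S (i.1%:Z, i.2%:Z).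
suff: S_factors x S \subset [set f i | i in [set: 'I_D * 'I_D]]%SET.
  move/subset_leq_card => /leq_trans; apply.
  apply: leq_trans (leq_imset_card _ _) _.
  by rewrite cardsT card_prod card_ord.
apply/fintype.subsetP => g; rewrite inE => /asboolP[t ->]; apply/imsetP.
have Dz : D%:Z != 0 by case: D D0 {hp hq f}.
have red (c : int) : (`|(c %% D)%Z| < D)%N.
  by have := modz_ge0 c Dz; have := ltz_mod c Dz; lia.
exists (Ordinal (red t.1), Ordinal (red t.2)) => //.
apply/ffunP => s; rewrite !ffunE /= !gez0_abs ?modz_ge0 //.
rewrite -[RHS](period_mulrz (t.1 %/ D)%Z hp) -[RHS](period_mulrz (t.2 %/ D)%Z hq).
congr x; rewrite !mulrz_pair.
rewrite [LHS]surjective_pairing; congr pair => /=.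
  have := divz_eq t.1 D.
  by move: (t.1 %/ D)%Z (t.1 %% D)%Z => a b ->; ring.
by rewrite [in LHS](divz_eq t.2 D) !mul0r addr0 addrAC mulrC; ring.
Qed.

(** * Recurrence and copies of points *)

Definition recurrent (A : Type) (x : Z2 -> A) : Prop :=
  forall W : seq Z2, exists2 u : Z2, u != 0 & {in W, forall z, x (z + u) = x z}.

Lemma strongly_recurrent_recurrent (R : realType) (A : Type) (x : Z2 -> A) :
  strongly_recurrent R x -> recurrent x.
Proof.
case=> delta [_ hN] W.
have [N hW] : exists N, {in W, forall z, in_box N z}.
  elim: W => [|w W [N IH]]; first by exists 0%N.
  exists (N + `|w.1| + `|w.2|)%N => z; rewrite inE => /predU1P[->|/IH].
    by rewrite /in_box; lia.
  by rewrite /in_box; lia.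
(* The successor makes the radius positive, as [hN] requires. *)
have [u [v [u0 _ hu _]]] := hN N.+1 isT.
exists u => // z /hW hz; apply: (hu z _).1.
by move: hz; rewrite /in_box; lia.
Qed.

(* Either one of the finitely many return vectors in [F] is a genuine period,
   and then so are its multiples, or each of them fails at some point, and these
   points can be added to [W]. *)
Lemma recurrent_avoid (A : Type) (x : Z2 -> A) (W F : seq Z2) :
  recurrent x -> exists2 u, u \notin F & {in W, forall z, x (z + u) = x z}.
Proof.
move=> hx.
have [[p p0 hp]|nper] := pselect (exists2 p : Z2, p != 0 & forall t, x (t + p) = x t).
  pose s := [seq p *+ i | i <- iota 0 (size F).+1].
  have : ~~ all (mem F) s.
    apply/negP => /allP sF; have us : uniq s.
      by rewrite map_inj_uniq ?iota_uniq //; exact: mulrn_inj.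
    by have := uniq_leq_size us sF; rewrite size_map size_iota ltnn.
  case/allPn => _ /mapP[i _ ->] hF; exists (p *+ i) => // z _.
  exact: period_mulrn.
have /choice[bad hbad] (u : Z2) : exists z, u != 0 -> x (z + u) <> x z.
  have [->|u0] := eqVneq u 0; first by exists 0.
  apply: contrapT => hz; apply: nper; exists u => // t.
  by apply: contrapT => ht; apply: hz; exists t.
have [u u0 hu] := hx (W ++ [seq bad u | u <- F]).
exists u => [|z zW]; last by apply: hu; rewrite mem_cat zW.
apply/negP => uF; apply: hbad (u0) _; apply: hu.
by rewrite mem_cat map_f ?orbT.
Qed.

(** Repetitions in [s] are traded for distinct points: each entry [w] is moved by a return vector of
    all the points [t + w], chosen outside the differences that would send [w] onto a point already
    taken. *)
Lemma recurrent_fset_count (x : Z2 -> bool) (ts s : seq Z2) :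
  recurrent x ->
  exists2 S : {fset Z2}, #|` S| = size s &
    {in ts, forall t, count (fun z => x (t + z)) S = count (fun z => x (t + z)) s}.
Proof.
move=> hx; suff [s' us' [<- hs']] : exists2 s', uniq s' & size s' = size s /\
    {in ts, forall t, count (fun z => x (t + z)) s' = count (fun z => x (t + z)) s}.
  have /permP ps' : perm_eq [fset z in s']%fset s'.
    by apply: uniq_perm => // z; rewrite in_fset.
  exists [fset z in s']%fset; first by have := ps' predT; rewrite !count_predT.
  by move=> t tts; rewrite ps' hs'.
elim: s => [|w s [s' us' [szs' hs']]]; first by exists [::].
have [u uF hu] := recurrent_avoid [seq t + w | t <- ts] [seq z - w | z <- s'] hx.
exists (w + u :: s'); last split; rewrite /= ?szs' //.
  rewrite us' andbT; apply: contra uF => uws'.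
  by apply/mapP; exists (w + u); rewrite // addrAC subrr add0r.
move=> t tts; have -> : x (t + (w + u)) = x (t + w).
  by rewrite addrA hu //; apply/mapP; exists t.
by congr (_ + _)%N; exact: hs'.
Qed.

(* The point of index [j] is repeated [2 ^ j] times. *)
Fixpoint binary_weights (T : Type) (s : seq T) : seq T :=
  if s is z :: s' then z :: binary_weights s' ++ binary_weights s' else [::].

(** The parity of the count gives the value at the head; removing it and halving leaves the count
    for the tail. *)
Lemma count_binary_weights_inj (T : eqType) (a b : pred T) (s : seq T) :
  count a (binary_weights s) = count b (binary_weights s) -> {in s, a =1 b}.
Proof.
elim: s => //= z s IHs; rewrite !count_cat !addnn => e.
have ez : a z = b z by have := congr1 odd e; rewrite !oddD !odd_double !addbF !oddb.
move: e; rewrite ez => /addnI /double_inj /IHs hs w.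
by rewrite inE => /predU1P[->|/hs].
Qed.

(** * Bounded complexity forces periods *)

Lemma abelian_equiv_count (x : Z2 -> bool) (S : {fset Z2}) (t t' : Z2) :
  abelian_equiv (S_factor x S t) (S_factor x S t') ->
  count (fun z => x (t + z)) S = count (fun z => x (t' + z)) S.
Proof.
have E r : #|[pred s | S_factor x S r s == true]| = count (fun z => x (r + z)) S.
  rewrite enum_fsetE count_map cardE /enum_mem size_filter count_filter.
  by apply: eq_in_count => s _; rewrite /= inE ffunE eqb_id andbT.
by move/forallP/(_ true)/eqP; rewrite !E.
Qed.

Lemma leq_abelian_complexity (x : Z2 -> bool) (S : {fset Z2}) (n : nat)
    (t : 'I_n -> Z2) :
  injective (fun i => count (fun z => x (t i + z)) S) ->
  (n <= abelian_complexity x S)%N.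
Proof.
move=> t_inj; pose f i := S_factor x S (t i).
have fS i : f i \in S_factors x S by rewrite inE; apply/asboolP; exists (t i).
(* [P i] is the block of [f i] in the partition that defines the complexity. *)
pose P i := [set g in S_factors x S | abelian_equiv (f i) g]%SET.
have P_inj : injective P.
  move=> i j e; have : f j \in P j by rewrite finset.in_set fS; apply/forallP.
  by rewrite -e finset.in_set => /andP[_ /abelian_equiv_count /t_inj].
rewrite -{1}(card_ord n) -(card_imset _ P_inj); apply/subset_leq_card.
by apply/fintype.subsetP => _ /imsetP[i _ ->]; apply: imset_f.
Qed.

Lemma finitely_many_translates (x : Z2 -> bool) (n : nat) :
  recurrent x ->
  (forall S : {fset Z2}, (0 < #|` S|)%N -> (abelian_complexity x S <= n)%N) ->
  forall t : 'I_n.+1 -> Z2,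
    exists i j, i != j /\ forall z, x (t i + z) = x (t j + z).
Proof.
move=> hx hn t; apply: contrapT => hne.
(* A point separating each pair of translates; diagonal pairs get the dummy 0. *)
have /choice[d hd] (ij : 'I_n.+1 * 'I_n.+1) :
    exists z, ij.1 != ij.2 -> x (t ij.1 + z) <> x (t ij.2 + z).
  case: ij => i j /=; have [->|ij] := eqVneq i j; first by exists 0.
  apply: contrapT => hz; apply: hne; exists i, j; split=> // z.
  by apply: contrapT => hxz; apply: hz; exists z.
pose s := [seq d ij | ij <- enum {: 'I_n.+1 * 'I_n.+1}].
have [S cS hS] :=
  recurrent_fset_count [seq t i | i <- enum 'I_n.+1] (binary_weights s) hx.
have S0 : (0 < #|` S|)%N.
  rewrite cS; have : (0 < size s)%N by rewrite size_map -cardE card_prod card_ord.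
  by case: (s).
have := hn _ S0; rewrite leqNgt => /negP; apply; apply: (@leq_abelian_complexity _ _ _ t).
move=> i j; rewrite !hS ?map_f ?mem_enum // => /count_binary_weights_inj e.
apply/eqP/negPn/negP => ij; apply: (hd (i, j) ij).
by apply: e; rewrite map_f ?mem_enum.
Qed.

(** Among the translates by [0, v, ..., n v] two coincide, and the difference of their positions is
    a period. *)
Lemma translates_period (x : Z2 -> bool) (n : nat) (v : Z2) :
  (forall t : 'I_n.+1 -> Z2,
    exists i j, i != j /\ forall z, x (t i + z) = x (t j + z)) ->
  exists2 m : int, m != 0 & forall t, x (t + v *~ m) = x t.
Proof.
move=> /(_ (fun i => v *~ i%:Z))[i [j [ij hij]]].
exists (i%:Z - j%:Z); first by rewrite subr_eq0 eqz_nat.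
move=> t; rewrite mulrzBr addrCA hij; congr x.
by rewrite addrA addrAC subrr add0r.
Qed.

Lemma abelian_complexity_bounded (R : realType) (A : finType) (x : Z2 -> A) :
  (ereal_sup [set max_abelian_complexity x R k | k in [set k : nat | (1 <= k)%N]]
     < +oo)%E <->
  exists n : nat, forall S : {fset Z2},
    (0 < #|` S|)%N -> (abelian_complexity x S <= n)%N.
Proof.
set M := ereal_sup _; split=> [hM|[n hn]]; last first.
  apply: (@le_lt_trans _ _ n%:R%:E); last exact: ltry.
  apply: ge_ereal_sup => _ [k k0 <-]; apply: ge_ereal_sup => _ [S Sk <-].
  by rewrite lee_fin ler_nat hn // Sk.
have le S : (0 < #|` S|)%N -> ((abelian_complexity x S)%:R%:E <= M)%E.
  move=> S0; apply: le_trans (ereal_sup_ubound _); last by exists #|` S|.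
  by apply: ereal_sup_ubound; exists S.
(* A supremum of [-oo] cannot dominate a real complexity, so only a real [r] remains, which is
   rounded up. *)
move: M hM le => [r| |] // _ le; last by exists 0%N => S /le.
exists (Num.bound `|r|) => S /le; rewrite lee_fin => hr.
by rewrite -(ler_nat R) (le_trans hr) // (le_trans (ler_norm r)) // ltW // archi_boundP.
Qed.

Theorem theorem1p7 (R : realType) (x : Z2 -> bool)
  (hx : strongly_recurrent R x) :
  doubly_periodic R x <->
  (ereal_sup [set max_abelian_complexity x R k | k in [set k : nat | (1 <= k)%N]]
     < +oo)%E.
Proof.
rewrite abelian_complexity_bounded; split.
  case/doubly_periodic_axes => D D0 [hp hq]; exists (D * D)%N => S _.
  exact: abelian_complexity_axes_le.
case=> n /(finitely_many_translates (strongly_recurrent_recurrent hx)) ht.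
have [a a0 ha] := translates_period (1, 0) ht.
have [b b0 hb] := translates_period (0, 1) ht.
exists ((1, 0) *~ a), ((0, 1) *~ b); split=> //.
by rewrite free_to_R2 !mulrz_pair /= !mul1r !mul0r subr0 mulf_neq0.
Qed.
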